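(* Every Banff quiver is contained in the class $\mathcal{P}$.
   Context: A quiver $Q=(Q_0,Q_1)$ is a finite multidigraph (multiple arrows allowed), with at least one vertex, without loops and directed 2-cycles, with vertex set $Q_0$ and arrow set $Q_1$. It is acyclic if it contains no directed cycles. For $S\subseteq Q_0$, $Q\setminus S$ denotes the full subquiver induced by the vertices $Q_0\setminus S$, i.e. all arrows of $Q$ that start and end in $Q_0\setminus S$. Mutation of $Q$ at a vertex $i$: $\mu_i(Q)$ is obtained from $Q$ by (1) for each path $j\to i\to k$ of length 2 through $i$ (counted with multiplicity) adding an arrow $j\to k$; (2) reversing all arrows that begin or end at $i$; (3) deleting (cancelling, pair by pair) the 2-cycles that have appeared as a result of step (1). All vertices are mutable. Two quivers are mutation-equivalent if one is obtained from the other by a finite sequence of mutations. A bi-infinite path in $Q$ is a sequence $(i_a)_{a\in\mathbb{Z}}$ of vertices such that $i_a\to i_{a+1}$ is an arrow of $Q$ for every $a\in\mathbb{Z}$ (vertices may repeat). A pair of vertices $(i,j)$ is a covering pair if $i\to j$ is an arrow in $Q$ which is not part of any bi-infinite path. The class $\mathcal{B}$ of Banff quivers is the smallest class of quivers such that: any acyclic quiver is Banff; any quiver mutation-equivalent to a Banff quiver is Banff; and any quiver $Q$ with a covering pair $(i,j)$ such that both $Q\setminus\{i\}$ and $Q\setminus\{j\}$ are Banff is Banff. Given quivers $A$ and $B$ with disjoint vertex sets, a triangular extension of $A$ and $B$ is a quiver $Q$ with $Q_0=A_0\cup B_0$ and $Q_1=A_1\cup B_1\cup E$, where $E$ is a (possibly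 empty) set of arrows which either all go from vertices of $A$ to vertices of $B$, or all go from vertices of $B$ to vertices of $A$. The class $\mathcal{P}$ is the smallest class of quivers such that: the trivial quiver with one vertex and no arrows is in $\mathcal{P}$; any quiver mutation-equivalent to a quiver in $\mathcal{P}$ is in $\mathcal{P}$; and any triangular extension of two quivers in $\mathcal{P}$ is in $\mathcal{P}$. *)

(* Defs.v *)
From HB Require Import structures.
From mathcomp Require Import all_boot all_order all_algebra.

Set Implicit Arguments.
Unset Strict Implicit.
Unset Printing Implicit Defensive.

(* A quiver with vertex set T is given by its arrow multiplicities:
   arr Q i j is the number of arrows i -> j.  The multiplicities are finite
   functions and the conditions are boolean, so that Leibniz equality of quivers
   on T is equality of all multiplicities. *)
Record quiver (T : finType) := Quiver {
  arr : {ffun T -> {ffun T -> nat}};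
  quiver_loopless : [forall i, arr i i == 0];
  quiver_no2cycle : [forall i, forall j, (arr i j == 0) || (arr j i == 0)];
  quiver_nonempty : 0 < #|T| }.

Definition adj (T : finType) (Q : quiver T) : rel T :=
  fun i j => 0 < arr Q i j.

Definition acyclic (T : finType) (Q : quiver T) : Prop :=
  forall c : seq T, cycle (adj Q) c -> c = [::].

Section Subquiver.
Variables (T : finType) (Q : quiver T) (S : {set T}).

Definition del_arr :
    {ffun {x : T | x \notin S} -> {ffun {x : T | x \notin S} -> nat}} :=
  [ffun i => [ffun j => arr Q (val i) (val j)]].

Lemma del_loopless : [forall i, del_arr i i == 0].
Proof.
by apply/forallP => i; rewrite !ffunE; apply: (forallP (quiver_loopless Q)).
Qed.

Lemma del_no2cycle :
  [forall i, forall j, (del_arr i j == 0) || (del_arr j i == 0)].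
Proof.
apply/forallP => i; apply/forallP => j; rewrite !ffunE.
exact: (forallP (forallP (quiver_no2cycle Q) _)).
Qed.

Lemma del_nonempty : ~: S != set0 -> 0 < #|{: {x : T | x \notin S}}|.
Proof.
by case/set0Pn => x; rewrite in_setC => xS; apply/card_gt0P; exists (Sub x xS).
Qed.

(* Q \ S; a quiver is nonempty, hence the hypothesis. *)
Definition del (neS : ~: S != set0) : quiver {x : T | x \notin S} :=
  Quiver del_loopless del_no2cycle (del_nonempty neS).

End Subquiver.

Section Mutation.
Variables (T : finType) (Q : quiver T) (i : T).

Definition mut_compose (j k : T) : nat := arr Q j k + arr Q j i * arr Q i k.

Definition mut_reverse (j k : T) : nat :=
  if (j == i) || (k == i) then mut_compose k j else mut_compose j k.

(* Cancelling 2-cycles pair by pair leaves the truncated difference. *)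
Definition mut_arr : {ffun T -> {ffun T -> nat}} :=
  [ffun j => [ffun k => mut_reverse j k - mut_reverse k j]].

Lemma mut_loopless : [forall j, mut_arr j j == 0].
Proof. by apply/forallP => j; rewrite !ffunE subnn. Qed.

Lemma mut_no2cycle :
  [forall j, forall k, (mut_arr j k == 0) || (mut_arr k j == 0)].
Proof.
by apply/forallP => j; apply/forallP => k; rewrite !ffunE !subn_eq0 leq_total.
Qed.

Definition mutate : quiver T :=
  Quiver mut_loopless mut_no2cycle (quiver_nonempty Q).

End Mutation.

Definition mutation_equivalent (T : finType) (Q R : quiver T) : Prop :=
  exists s : seq T, R = foldl (@mutate T) Q s \/ Q = foldl (@mutate T) R s.

Definition biinfinite_path (T : finType) (Q : quiver T) (p : int -> T) : Prop :=
  forall a : int, adj Q (p a) (p (a + 1)%R).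

Definition covering_pair (T : finType) (Q : quiver T) (i j : T) : Prop :=
  adj Q i j /\
  ~ (exists p : int -> T, biinfinite_path Q p /\
       exists a : int, p a = i /\ p (a + 1)%R = j).

Lemma covering_pair_neq (T : finType) (Q : quiver T) (i j : T) :
  covering_pair Q i j -> i != j.
Proof.
case; rewrite /adj => ij _; apply: contraTneq ij => ->.
by rewrite (eqP (forallP (quiver_loopless Q) j)).
Qed.

Lemma covering_pair_nel (T : finType) (Q : quiver T) (i j : T) :
  covering_pair Q i j -> ~: [set i] != set0.
Proof.
by move=> /covering_pair_neq ij; apply/set0Pn; exists j; rewrite !inE eq_sym.
Qed.

Lemma covering_pair_ner (T : finType) (Q : quiver T) (i j : T) :
  covering_pair Q i j -> ~: [set j] != set0.
Proof.
by move=> /covering_pair_neq ij; apply/set0Pn; exists i; rewrite !inE.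
Qed.

Inductive banff : forall T : finType, quiver T -> Prop :=
| banff_acyclic (T : finType) (Q : quiver T) : acyclic Q -> banff Q
| banff_mutation (T : finType) (Q R : quiver T) :
    mutation_equivalent R Q -> banff R -> banff Q
| banff_covering (T : finType) (Q : quiver T) (i j : T)
    (cov : covering_pair Q i j) :
    banff (del Q (covering_pair_nel cov)) ->
    banff (del Q (covering_pair_ner cov)) ->
    banff Q.

(* Vertex sets being types, "Q_0 is the disjoint union of A_0 and B_0" is a
   bijection h from the sum type; the arrows of E are those between the images of
   the two summands. *)
Definition triangular_extension (TA TB T : finType)
    (A : quiver TA) (B : quiver TB) (Q : quiver T) : Prop :=
  exists h : TA + TB -> T,
    [/\ bijective h,
        forall a a' : TA, arr Q (h (inl a)) (h (inl a')) = arr A a a',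
        forall b b' : TB, arr Q (h (inr b)) (h (inr b')) = arr B b b' &
        (forall (a : TA) (b : TB), arr Q (h (inr b)) (h (inl a)) = 0) \/
        (forall (a : TA) (b : TB), arr Q (h (inl a)) (h (inr b)) = 0)].

(* A quiver with a single vertex has no arrows, having no loops. *)
Inductive classP : forall T : finType, quiver T -> Prop :=
| classP_trivial (T : finType) (Q : quiver T) : #|T| = 1 -> classP Q
| classP_mutation (T : finType) (Q R : quiver T) :
    mutation_equivalent R Q -> classP R -> classP Q
| classP_extension (TA TB T : finType)
    (A : quiver TA) (B : quiver TB) (Q : quiver T) :
    triangular_extension A B Q -> classP A -> classP B -> classP Q.

(* Main.v *)
Require Import Defs.
From mathcomp Require Import all_boot all_order all_algebra.

(** If [(i, j)] is a covering pair, then either no infinite backward walk ends at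
    [i] or no infinite forward walk starts at [j]. In the first case, mutate
    successively at sources other than [i]: such a mutation only turns the source
    into a sink, so it creates no infinite backward walk at [i], and as the
    predecessors of [i] run out, [i] itself becomes a source. The final quiver is
    then a triangular extension of the single vertex [i] and of a quiver
    mutation-equivalent to [Q \ {i}]. The second case is dual, and acyclic quivers
    are handled by the same argument, deleting one vertex at a time. *)

Set Implicit Arguments.
Unset Strict Implicit.
Unset Printing Implicit Defensive.

Lemma quiver_eq (T : finType) (Q R : quiver T) :
  (forall i j, arr Q i j = arr R i j) -> Q = R.
Proof.
move=> QR; have {QR}: arr Q = arr R.
  by apply/ffunP => i; apply/ffunP => j; apply: QR.
case: Q R => [a l1 n1 c1] [a' l2 n2 c2] /= eq_a; case: _ / eq_a l2 n2 => l2 n2.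
congr Quiver; exact: bool_irrelevance.
Qed.

Lemma arr_loop (T : finType) (Q : quiver T) i : arr Q i i = 0.
Proof. exact/eqP/(forallP (quiver_loopless Q)). Qed.

(** Taking [b] false reverses every arrow, so one argument serves sources and sinks alike. *)
Definition dir_arr (b : bool) (T : finType) (Q : quiver T) (i j : T) : nat :=
  if b then arr Q i j else arr Q j i.

(* A source if [b], a sink otherwise. *)
Definition extremal b (T : finType) (Q : quiver T) (s : T) : Prop :=
  forall y, dir_arr b Q y s = 0.

(** No path of length 2 passes through [s], so mutation merely reverses the arrows at [s]. *)
Lemma mutate_extremal b (T : finType) (Q : quiver T) s : extremal b Q s ->
  forall j k, dir_arr b (mutate Q s) j k =
    if (j == s) || (k == s) then dir_arr b Q k j else dir_arr b Q j k.
Proof.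
move=> ext_s.
have arrE j k : arr (mutate Q s) j k =
    if (j == s) || (k == s) then arr Q k j else arr Q j k.
  have comp0 x y : arr Q x s * arr Q s y = 0.
    case: b ext_s => ext_s; first by rewrite (ext_s x : arr Q x s = 0).
    by rewrite (ext_s y : arr Q s y = 0) muln0.
  rewrite !ffunE /mut_reverse /mut_compose !comp0 !addn0 (orbC (k == s)).
  have /orP[/eqP jk0 | /eqP kj0] :=
    forallP (forallP (quiver_no2cycle Q) j) k.
    by rewrite jk0; case: ifP; rewrite ?subn0.
  by rewrite kj0; case: ifP; rewrite ?subn0.
by case: b {ext_s} => j k; rewrite /dir_arr arrE // (orbC (k == s)).
Qed.

Lemma mutate_del (T : finType) (Q : quiver T) (S : {set T})
    (neS : ~: S != set0) (s : {x : T | x \notin S}) :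
  mutate (del Q neS) s = del (mutate Q (val s)) neS.
Proof.
by apply: quiver_eq => j k; rewrite !ffunE /mut_reverse /mut_compose !ffunE.
Qed.

Lemma classP_mutate (T : finType) (Q : quiver T) s :
  classP Q <-> classP (mutate Q s).
Proof.
by split; apply: classP_mutation; exists [:: s]; [left | right].
Qed.

Definition point_arr : {ffun unit -> {ffun unit -> nat}} :=
  [ffun=> [ffun=> 0]].

Lemma point_loopless : [forall i, point_arr i i == 0].
Proof. by apply/forallP => i; rewrite !ffunE. Qed.

Lemma point_no2cycle :
  [forall i, forall j, (point_arr i j == 0) || (point_arr j i == 0)].
Proof. by apply/forallP => i; apply/forallP => j; rewrite !ffunE. Qed.

Lemma point_nonempty : 0 < #|{: unit}|.
Proof. by rewrite card_unit. Qed.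

Definition point : quiver unit :=
  Quiver point_loopless point_no2cycle point_nonempty.

Lemma classP_extremal b (T : finType) (Q : quiver T) i
    (ne : ~: [set i] != set0) :
  extremal b Q i -> classP (del Q ne) -> classP Q.
Proof.
move=> ext_i; apply: (@classP_extension _ _ _ point).
  pose h (u : unit + {x : T | x \notin [set i]}) :=
    if u is inr x then val x else i.
  exists h; split.
  - exists (fun x => if insub x is Some y then inr y else inl tt) => [[[]|y]|x].
    + by rewrite insubN // !inE eqxx.
    + by rewrite /= valK.
    + by case: insubP => [y _ <- //|]; rewrite !inE negbK => /eqP->.
  - by move=> [] []; rewrite !ffunE arr_loop.
  - by move=> x y; rewrite !ffunE.
  - by case: b ext_i => ext_i; [left | right] => a y; apply: ext_i.
by apply: classP_trivial; rewrite card_unit.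
Qed.

(* Says, without quantifying over walks, that an infinite backward (forward,
   if [~~ b]) walk leaves [i]. *)
Definition unending b (T : finType) (Q : quiver T) (i : T) : bool :=
  [exists D : {set T},
     (i \in D) && [forall x in D, [exists y in D, 0 < dir_arr b Q y x]]].

Lemma unending_iter b (T : finType) (Q : quiver T) i : unending b Q i ->
  exists f : T -> T, forall n, 0 < dir_arr b Q (iter n.+1 f i) (iter n f i).
Proof.
case/existsP => D /andP[iD /'forall_in_existsP nextD].
pose f x := odflt x [pick y in D | 0 < dir_arr b Q y x].
have fD x : x \in D -> (f x \in D) && (0 < dir_arr b Q (f x) x).
  move=> /nextD exD; rewrite /f; case: pickP => //= no.
  by case: exD => y; rewrite no.
exists f => n; suff: iter n f i \in D by case/fD/andP.
by elim: n => //= n /fD/andP[].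
Qed.

(** By finiteness the walk along predecessors repeats a vertex; the stretch in between, reversed, is
    a directed cycle. *)
Lemma acyclic_not_unending (T : finType) (Q : quiver T) i :
  acyclic Q -> ~~ unending true Q i.
Proof.
move=> acQ; apply/negP => /unending_iter[f fP].
have /trajectP[k lt_k eq_k] : looping f i (fingraph.order f i).
  exact: looping_order.
pose n := fingraph.order f i - k; pose y := iter k f i.
have yP m : adj Q (iter m.+1 f y) (iter m f y).
  by rewrite -!iterD; apply: fP.
have n_gt0 : 0 < n by rewrite subn_gt0.
have fny : iter n f y = y by rewrite -iterD subnK // ltnW.
suff /acQ/(congr1 size): cycle (adj Q) (rev (traject f y n)).
  by rewrite size_rev size_traject => n0; rewrite n0 in n_gt0.
rewrite rev_cycle; case: n n_gt0 fny => // n _ fny.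
(* Writing the closing vertex [y] as [iter n.+1 f y] turns the cycle into a stretch of the walk. *)
rewrite /= -[X in rcons _ X]fny iterSr -trajectSr.
apply/(pathP y) => m; rewrite size_traject => lt_m.
have := yP m; rewrite -(nth_traject f (leqW lt_m : m < n.+2) y).
by rewrite -(nth_traject f (lt_m : m.+1 < n.+2) y).
Qed.

(** A witness for the mutated quiver, with [s] removed, is one for [Q]: after mutation no walk can
    step to [s]. *)
Lemma not_unending_mutate b (T : finType) (Q : quiver T) s i :
  extremal b Q s -> s != i -> ~~ unending b Q i ->
  ~~ unending b (mutate Q s) i.
Proof.
move=> ext_s s_i; apply: contraNN.
case/existsP => D /andP[iD /'forall_in_existsP nextD]; apply/existsP.
exists (D :\ s); rewrite !inE eq_sym s_i iD /=.
apply/'forall_in_existsP => x /setD1P[x_s xD].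
have [y /andP[yD]] := nextD x xD; rewrite (mutate_extremal ext_s).
rewrite (negPf x_s) orbF; case: eqVneq => [->|y_s xy]; first by rewrite ext_s.
by exists y; rewrite !inE y_s yD.
Qed.

Lemma classP_not_unending b (T : finType) (Q : quiver T) i
    (ne : ~: [set i] != set0) :
  ~~ unending b Q i -> classP (del Q ne) -> classP Q.
Proof.
(* The full set is generalised to a set [D] containing [i] and closed under walk steps; the
   induction is on its size. *)
have: forall x y : T, 0 < dir_arr b Q y x -> x \in setT -> y \in setT by [].
have: i \in setT by [].
have [n] := ubnP #|[set: T]|.
elim: n Q [set: T] => // n IHn Q D leDn iD closedD endQ clQ.
(* Since [D] does not witness [unending], some [s] in [D] has no next vertex in [D], hence none at
   all by closedness. *)
have [s sD ext_s] : exists2 s, s \in D & extremal b Q s.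
  move: endQ; rewrite negb_exists => /forallP/(_ D); rewrite iD /=.
  case/forall_inPn => s sD /exists_inPn no_y; exists s => // y.
  apply/eqP; rewrite -leqn0 leqNgt; apply/negP => ys.
  by have /no_y/negP := closedD s y ys sD.
have [si|s_i] := eqVneq s i.
  by apply: (classP_extremal (b := b)) clQ; rewrite -si.
have sN : s \notin [set i] by rewrite inE.
(* After mutation no step leads to [s], so [D :\ s] is again closed. *)
apply/(classP_mutate Q s)/(IHn _ (D :\ s)).
- by rewrite -ltnS (leq_trans _ leDn) // ltnS [in X in _ < X](cardsD1 s) sD.
- by rewrite !inE eq_sym s_i.
- move=> x y; rewrite (mutate_extremal ext_s) !inE => xy /andP[x_s xD].
  move: xy; rewrite (negPf x_s) orbF.
  by case: eqVneq => [->|_ /closedD->] //; rewrite ext_s.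
- exact: not_unending_mutate.
(* As [s] differs from [i], mutating at [s] commutes with deleting [i]. *)
- by rewrite -(mutate_del Q ne (Sub s sN)); apply: (classP_mutate _ _).1.
Qed.

Lemma acyclic_del (T : finType) (Q : quiver T) (S : {set T})
    (neS : ~: S != set0) : acyclic Q -> acyclic (del Q neS).
Proof.
move=> acQ c cyc; suff /acQ: cycle (adj Q) (map val c) by case: c {cyc}.
rewrite cycle_map; apply: sub_cycle cyc => x y.
by rewrite /adj !ffunE.
Qed.

Lemma acyclic_classP (T : finType) (Q : quiver T) : acyclic Q -> classP Q.
Proof.
have [n] := ubnP #|T|; elim: n T Q => // n IHn T Q leTn acQ.
have /card_gt0P[i _] := quiver_nonempty Q.
have cardT : #|T| = #|~: [set i]|.+1 by rewrite -(cardsC [set i]) cards1.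
have [T1|ne] := eqVneq (~: [set i]) set0.
  by apply: classP_trivial; rewrite cardT T1 cards0.
apply: (classP_not_unending (ne := ne) (acyclic_not_unending i acQ)).
apply: IHn; last exact: acyclic_del.
rewrite card_sig -ltnS; apply: leq_trans leTn; rewrite cardT !ltnS.
by apply/subset_leq_card/subsetP => x; rewrite !inE.
Qed.

(** Otherwise a backward walk from [i], the arrow and a forward walk from [j] join into a
    bi-infinite path. *)
Lemma covering_pair_not_unending (T : finType) (Q : quiver T) i j :
  covering_pair Q i j -> ~~ unending true Q i || ~~ unending false Q j.
Proof.
case=> adj_ij no_path; rewrite -negb_and; apply/negP.
case/andP => /unending_iter[f fP] /unending_iter[g gP]; apply: no_path.
(* [Negz n] is [-(n+1)], so [j] sits at index 0 and [i] at index -1. *)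
exists (fun a => match a with Posz n => iter n g j | Negz n => iter n f i end).
split; last by exists (Negz 0).
move=> [n|[|n]].
- by rewrite -PoszD addn1; apply: gP.
- exact: adj_ij.
- have -> : (Negz n.+1 + 1)%R = Negz n.
    by rewrite !NegzE [in LHS]intS GRing.opprD GRing.addrC GRing.addNKr.
  exact: fP.
Qed.

Theorem corollary3p4 (T : finType) (Q : quiver T) : banff Q -> classP Q.
Proof.
elim=> {T Q} [T Q|T Q R eqRQ _|T Q i j cov _ clQi _ clQj].
- exact: acyclic_classP.
- exact: classP_mutation.
- have /orP[end_i|end_j] := covering_pair_not_unending cov.
  + exact: classP_not_unending end_i clQi.
  + exact: classP_not_unending end_j clQj.
Qed.
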